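(* Let $P_1(x)=p_0+p_1x+\dots+p_mx^m$ and $P_2(x)=p'_0+p'_1x+\dots+p'_nx^n$ be polynomials in $\mathcal E[x]$ such that, for $i\in\{1,2\}$, $\mathcal R_i=\mathcal E[x]/(P_i)$ with a set $\mathcal N_i\subset\mathcal E$ of representatives of $\mathcal R_i/(X)$ forms a digit system $(\mathcal R_i,X,\mathcal N_i)$. Let $\mathcal M=\{d+eP_1: d\in\mathcal N_1, e\in\mathcal N_2\}$ (viewed in $\mathcal E[x]/(P_1P_2)$). Then: (1) $(\mathcal E[x]/(P_1P_2),X,\mathcal M)$ is a digit system; (2) if $0\in\mathcal N_1$ and both $(\mathcal R_1,X,\mathcal N_1)$ and $(\mathcal R_2,X,\mathcal N_2)$ have the finite expansion property, then $(\mathcal E[x]/(P_1P_2),X,\mathcal M)$ has the finite expansion property; (3) if $0\in\mathcal N_1$, $(\mathcal R_1,X,\mathcal N_1)$ has the finite expansion property and $(\mathcal R_2,X,\mathcal N_2)$ has the periodic expansion property, then $(\mathcal E[x]/(P_1P_2),X,\mathcal M)$ has the periodic expansion property.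
   Context: $\mathcal E$ is a commutative ring with identity. A digit system is a triple $(\mathcal R,X,\mathcal N)$ where $\mathcal R=\mathcal E[x]/(P)$ for a polynomial $P=p_dx^d+\dots+p_0$ of degree $d\ge1$ with $p_d,p_0$ not zero divisors of $\mathcal E$ and $\mathcal E/(p_0)$ finite, $X$ is the image of $x$, and $\mathcal N\subset\mathcal R$ is a system of coset representatives of $\mathcal R/(X)$. For $A\in\mathcal R$, $D_{\mathcal N}(A)$ is the unique $e\in\mathcal N$ with $A\equiv e\pmod X$ and $T(A)=\frac{A-D_{\mathcal N}(A)}{X}$ (the unique $B$ with $XB=A-D_{\mathcal N}(A)$). Finite expansion property: for every $A\in\mathcal R$ there is $n\in\mathbb N$ with $T^n(A)=0$. Periodic expansion property: for every $A\in\mathcal R$ the sequence $(T^i(A))_{i\ge0}$ is eventually periodic. *)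

(* Defs.v *)
From HB Require Import structures.
From mathcomp Require Import all_boot all_order all_algebra.
From mathcomp Require Import generic_quotient ring_quotient.
From mathcomp Require Import boolp classical_sets functions cardinality.

Set Implicit Arguments.
Unset Strict Implicit.
Unset Printing Implicit Defensive.
Import GRing.Theory.

Local Open Scope ring_scope.
Local Open Scope quotient_scope.
Local Open Scope classical_set_scope.

(* The library equips R / I with a ring structure only when I is a proper
   ideal. Here R / (a) is made a possibly zero commutative ring for every a,
   on top of the library's additive quotient. *)
Section PrincipalQuotient.
Variables (R : comPzRingType) (a : R).

Definition principal : {pred R} := fun b => `[< exists u, b = u * a >].

Lemma principalP b : reflect (exists u, b = u * a) (b \in principal).
Proof. exact: asboolP. Qed.

Lemma principal_zmod_closed : zmod_closed principal.
Proof.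
split=> [|b c /principalP[u ->] /principalP[v ->]]; apply/principalP.
  by exists 0; rewrite mul0r.
by exists (u - v); rewrite mulrBl.
Qed.

HB.instance Definition _ :=
  GRing.isZmodClosed.Build R principal principal_zmod_closed.

Lemma principalMl b c : c \in principal -> b * c \in principal.
Proof.
by move=> /principalP[u ->]; apply/principalP; exists (b * u); rewrite mulrA.
Qed.

Definition pquot : Type := Quotient.quot principal.

HB.instance Definition _ := Choice.on pquot.
HB.instance Definition _ := EqQuotient.on pquot.
HB.instance Definition _ := GRing.Zmodule.on pquot.
HB.instance Definition _ := ZmodQuotient.on pquot.

Lemma pquotP b c : reflect (exists u, b - c = u * a) (b == c %[mod pquot]).
Proof. by rewrite -Quotient.idealrBE; apply: principalP. Qed.

Definition pquot_one : pquot := \pi_pquot 1.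
Definition pquot_mul : pquot -> pquot -> pquot := lift_op2 pquot *%R.

Lemma pi_pquot_mul :
  {morph \pi_pquot : b c / b * c >-> pquot_mul b c}.
Proof.
move=> b c; unlock pquot_mul; apply/eqP; rewrite -Quotient.idealrBE.
set b' := repr _; set c' := repr _.
have hb : b - b' \in principal by rewrite Quotient.idealrBE reprK.
have hc : c - c' \in principal by rewrite Quotient.idealrBE reprK.
have -> : b * c - b' * c' = b * (c - c') + c' * (b - b').
  by rewrite !mulrBr (mulrC c' b) (mulrC c' b') addrA subrK.
by rewrite rpredD ?principalMl.
Qed.

Fact pquot_mulA : associative pquot_mul.
Proof.
move=> x y z; rewrite -[x]reprK -[y]reprK -[z]reprK.
by rewrite -!pi_pquot_mul mulrA.
Qed.

Fact pquot_mulC : commutative pquot_mul.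
Proof. by move=> x y; rewrite -[x]reprK -[y]reprK -!pi_pquot_mul mulrC. Qed.

Fact pquot_mul1 : left_id pquot_one pquot_mul.
Proof. by move=> x; rewrite -[x]reprK -pi_pquot_mul mul1r. Qed.

Fact pquot_mulDl : left_distributive pquot_mul +%R.
Proof.
move=> x y z; rewrite -[x]reprK -[y]reprK -[z]reprK.
by rewrite -raddfD -!pi_pquot_mul mulrDl raddfD.
Qed.

HB.instance Definition _ := GRing.Zmodule_isComPzRing.Build pquot
  pquot_mulA pquot_mulC pquot_mul1 pquot_mulDl.

Lemma pi_pquotM : {morph \pi_pquot : b c / b * c >-> b * c}.
Proof. exact: pi_pquot_mul. Qed.

Definition is_coset_reps (N : set R) : Prop :=
  forall b : R, exists! e : R, N e /\ e = b %[mod pquot].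

End PrincipalQuotient.

Section DigitSystem.
Variables (E : comNzRingType) (P : {poly E}).
Implicit Types (N : set (pquot P)) (A : pquot P).

Definition qX : pquot P := \pi_(pquot P) 'X.

Definition embed (c : E) : pquot P := \pi_(pquot P) c%:P.

Record is_digit_system N : Prop := IsDigitSystem {
  ds_deg : (1 < size P)%N;
  ds_lead : GRing.lreg (lead_coef P);
  ds_const : GRing.lreg P`_0;
  ds_finite : finite_set [set: pquot P`_0];
  ds_reps : is_coset_reps qX N
}.

(* When N is a digit system, the sets below are singletons (qX is then not a
   zero divisor), so that the default value 0 of xget is never used. *)
Definition digit N A : pquot P :=
  xget 0 [set e | N e /\ e = A %[mod pquot qX]].

Definition digit_shift N A : pquot P :=
  xget 0 [set B | qX * B = A - digit N A].

Definition finite_expansion N : Prop :=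
  forall A, exists n : nat, iter n (digit_shift N) A = 0.

Definition periodic_expansion N : Prop :=
  forall A, exists n l : nat, (0 < l)%N /\
    forall i : nat, (n <= i)%N ->
      iter (i + l) (digit_shift N) A = iter i (digit_shift N) A.

End DigitSystem.

Definition product_digits (E : comNzRingType) (P1 P2 : {poly E})
    (N1 N2 : set E) : set (pquot (P1 * P2)) :=
  [set \pi_(pquot (P1 * P2)) (d%:P + e%:P * P1) | d in N1 & e in N2].

Arguments product_digits {E} P1 P2 N1 N2.

(* Main.v *)
Require Import Defs.
From mathcomp Require Import all_boot all_order all_algebra.
From mathcomp Require Import generic_quotient ring_quotient.
From mathcomp Require Import boolp classical_sets functions cardinality.
From mathcomp Require Import ring.

(** Modulo [X], a class of [E[x]/(P)] is determined by its constant term modulo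
    [p_0], so [N1] and [N2] represent [E/(p_0)] and [E/(p'_0)], and the constant
    terms [d + e p_0] of the elements of [M] represent [E/(p_0 p'_0)].
    Reduction modulo [P1] maps the shift of the product system to the shift of
    the first one, since the digit [d + e P1] reduces to [d]. Hence after
    finitely many shifts every element is a multiple of [P1]. As [0] is in [N1],
    multiplication by [P1] maps the shift of the second system to the shift of
    the product system, so from there on the expansion is the one of the
    second system. *)

Set Implicit Arguments.
Unset Strict Implicit.
Unset Printing Implicit Defensive.
Import GRing.Theory.

Local Open Scope ring_scope.
Local Open Scope quotient_scope.
Local Open Scope classical_set_scope.

Lemma iter_morph (S T : Type) (h : S -> T) (f : S -> S) (g : T -> T) :
  {morph h : x / f x >-> g x} -> forall n, {morph h : x / iter n f x >-> iter n g x}.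
Proof. by move=> hfg n x; elim: n => //= n <-; rewrite hfg. Qed.

Section PrincipalQuotientTheory.
Variables (R : comPzRingType) (a : R).

Lemma pi_pquot_eqP (b c : R) :
  \pi_(pquot a) b = \pi_(pquot a) c <-> exists u, b - c = u * a.
Proof. by split=> [/eqP/pquotP|/pquotP/eqP]. Qed.

Lemma pi_pquot_eq0P (b : R) : \pi_(pquot a) b = 0 <-> exists u, b = u * a.
Proof.
have := pi_pquot_eqP b 0; rewrite subr0.
by rewrite [\pi_(pquot a) 0]raddf0.
Qed.

Lemma pquot_ind (K : pquot a -> Prop) :
  (forall b, K (\pi_(pquot a) b)) -> forall x, K x.
Proof. by move=> Kpi x; rewrite -[x]reprK. Qed.

End PrincipalQuotientTheory.

(** Dividing by [a] and then the quotient by [b] writes every class as [x + y * a] with [x], [y]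
    from two finite sets. *)
Lemma finite_pquotM (R : comPzRingType) (a b : R) :
  finite_set [set: pquot a] -> finite_set [set: pquot b] ->
  finite_set [set: pquot (a * b)].
Proof.
move=> fina finb.
have := finite_image2
  (fun (x : pquot a) (y : pquot b) => \pi_(pquot (a * b)) (repr x + repr y * a))
  fina finb.
apply: sub_finite_set; elim/pquot_ind=> c _ /=.
have /pi_pquot_eqP[u cu] : \pi_(pquot a) c = \pi_(pquot a) (repr (\pi_(pquot a) c)).
  by rewrite reprK.
have /pi_pquot_eqP[v uv] : \pi_(pquot b) u = \pi_(pquot b) (repr (\pi_(pquot b) u)).
  by rewrite reprK.
exists (\pi_(pquot a) c) => //; exists (\pi_(pquot b) u) => //.
apply/esym/pi_pquot_eqP; exists v.
by rewrite opprD addrA cu -mulrBl uv -mulrA (mulrC b).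
Qed.

Lemma poly_divX (R : nzRingType) (f : {poly R}) :
  exists q, f = q * 'X + (f`_0)%:P.
Proof.
elim/poly_ind: f => [|q c _]; first by exists 0; rewrite coef0 mul0r addr0.
by exists q; rewrite coefD coefMX coefC add0r.
Qed.

Section QuotientByPoly.
Variables (E : comNzRingType) (P : {poly E}).

Lemma pi_eqmod_qXP (f g : {poly E}) :
  \pi_(pquot P) f = \pi_(pquot P) g %[mod pquot (qX P)] <->
  exists u, f`_0 - g`_0 = u * P`_0.
Proof.
split=> [/pi_pquot_eqP[U]|[u fgu]].
  elim/pquot_ind: U => u; rewrite -raddfB -pi_pquotM => /pi_pquot_eqP[v fgv].
  exists v`_0; rewrite -coef0M -fgv !coefD !coefN coefMX subr0 //.
(* Subtracting [u * P] kills the constant term, so what remains is a multiple of ['X]. *)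
have [q fgq] := poly_divX (f - g - u%:P * P).
apply/pi_pquot_eqP; exists (\pi_(pquot P) q).
rewrite -raddfB -pi_pquotM; apply/pi_pquot_eqP; exists u%:P.
move: fgq; rewrite 2!coefB coef0M coefC fgu subrr addr0 => <-.
by rewrite subKr.
Qed.

Lemma qX_lreg : GRing.lreg P`_0 -> GRing.lreg (qX P).
Proof.
move=> regP; apply: mulrI0_lreg; elim/pquot_ind=> f.
rewrite -pi_pquotM => /pi_pquot_eq0P[u Xf]; have [v uv] := poly_divX u.
have u0 : u`_0 = 0.
  by apply: regP; rewrite mulr0 mulrC -coef0M -Xf coefXM.
apply/pi_pquot_eq0P; exists v.
move: Xf; rewrite uv u0 addr0 mulrC mulrAC.
by move=> /(@monic_rreg _ 'X (monicX _)).
Qed.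

Section Digits.
Variable N : set (pquot P).
Hypothesis dsN : is_digit_system N.

(** Both sets given to [xget] are inhabited, so neither default value 0 is taken. *)
Lemma digit_shiftP A : exists2 e, N e & A = e + qX P * digit_shift N A.
Proof.
have [e [[Ne eA] _]] := ds_reps dsN A.
have [Nd dA] : N (digit N A) /\ digit N A = A %[mod pquot (qX P)].
  exact: (@xgetPex _ 0 [set e | N e /\ e = A %[mod pquot (qX P)]]) (ex_intro _ e _).
exists (digit N A) => //.
move/esym/pi_pquot_eqP: dA => [B AB].
rewrite [X in _ + X](_ : _ = A - digit N A) ?subrKC //.
apply: (@xgetPex _ 0 [set B | qX P * B = A - digit N A]).
by exists B; rewrite /= mulrC.
Qed.

(** Digits congruent modulo [qX P] coincide, and [qX P] cancels. Shifts can thus be computed by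
    exhibiting a decomposition. *)
Lemma digit_shift_eq e B : N e -> digit_shift N (e + qX P * B) = B.
Proof.
move=> Ne; have [d Nd] := digit_shiftP (e + qX P * B).
set C := digit_shift _ _ => eBdC.
have [c [_ uniq_c]] := ds_reps dsN e.
have ed : e = d.
  rewrite -(uniq_c e) // -(uniq_c d) //; split=> //.
  apply/pi_pquot_eqP; exists (B - C); rewrite mulrC mulrBr.
  by apply/eqP; rewrite subr_eq addrAC eq_sym subr_eq addrC eBdC addrC.
by apply: (qX_lreg (ds_const dsN)); apply: (addrI e); rewrite eBdC ed.
Qed.

End Digits.

(** A nonzero constant has smaller degree than [P], so it is no multiple of [P], whose leading
    coefficient is regular. *)
Lemma embed_inj :
  (1 < size P)%N -> GRing.lreg (lead_coef P) -> injective (embed P).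
Proof.
move=> gt1P regP c d /pi_pquot_eqP[u cd].
have /eqP : u * P + (d - c)%:P = 0 by rewrite -cd polyCB subrKA subrr.
rewrite rreg_div0; last 2 first.
- by move=> x y; rewrite !(mulrC _ (lead_coef P)) => /regP.
- exact: leq_ltn_trans (size_polyC_leq1 _) gt1P.
by case/andP=> _; rewrite polyC_eq0 subr_eq0 => /eqP.
Qed.

Section ConstantDigits.
Variable N : set E.
Hypothesis dsN : is_digit_system (embed P @` N).

Lemma const_digit_ex c : exists2 e, N e & exists u, c - e = u * P`_0.
Proof.
have [_ [[[e Ne <-]]]] := ds_reps dsN (embed P c).
move=> /esym/pi_eqmod_qXP[u]; rewrite !coefC => ce _.
by exists e => //; exists u.
Qed.

Lemma const_digit_inj d e u : N d -> N e -> d - e = u * P`_0 -> d = e.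
Proof.
move=> Nd Ne de; apply: (embed_inj (ds_deg dsN) (ds_lead dsN)).
have [c [_ uniq_c]] := ds_reps dsN (embed P e).
apply: (etrans (esym (uniq_c _ _)) (uniq_c _ _)); split.
- by exists d.
- by apply/pi_eqmod_qXP; exists u; rewrite !coefC.
- by exists e.
- by [].
Qed.

End ConstantDigits.
End QuotientByPoly.

Section Product.
Variables (E : comNzRingType) (P1 P2 : {poly E}) (N1 N2 : set E).
Hypothesis dsN1 : is_digit_system (embed P1 @` N1).
Hypothesis dsN2 : is_digit_system (embed P2 @` N2).

Let M := product_digits P1 P2 N1 N2.
Let T1 := digit_shift (embed P1 @` N1).
Let T2 := digit_shift (embed P2 @` N2).
Let T := digit_shift M.

Lemma product_reps : is_coset_reps (qX (P1 * P2)) M.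
Proof.
have coef0_digit d e : (d%:P + e%:P * P1)`_0 = d + e * P1`_0.
  by rewrite coefD coef0M !coefC.
elim/pquot_ind=> f.
have [d N1d [w fd]] := const_digit_ex dsN1 f`_0.
have [e N2e [v we]] := const_digit_ex dsN2 w.
exists (\pi_(pquot (P1 * P2)) (d%:P + e%:P * P1)); split.
  split; first by exists d => //; exists e.
  apply/esym/pi_eqmod_qXP; exists v.
  by rewrite coef0_digit opprD addrA fd -mulrBl we coef0M -mulrA (mulrC P2`_0).
move=> _ [[d' N1d' [e' N2e' <-]]].
move=> /esym/pi_eqmod_qXP[v'].
rewrite coef0_digit coef0M => fd'.
have regP1 := ds_const dsN1.
(* Both are congruent to [f]_0[modulo]P1[_0]. *)
have dd' : d = d'.
  apply: (@const_digit_inj _ _ _ dsN1 _ _ (e' + v' * P2`_0 - w)) => //.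
  rewrite mulrBl -fd mulrDl -mulrA (mulrC P2`_0) -fd'; ring.
rewrite -dd'; congr (\pi_(pquot (P1 * P2)) (_ + _%:P * _)).
(* With equal first digits, the regular [P1]_0[cancels, leaving a congruence modulo]P2[_0]. *)
apply: (@const_digit_inj _ _ _ dsN2 _ _ (v' - v)) => //.
rewrite mulrBl -we; apply: (regP1).
have -> : P1`_0 * (v' * P2`_0 - (w - e)) = v' * (P1`_0 * P2`_0) - w * P1`_0 + e * P1`_0 by ring.
rewrite -fd -fd' dd'; ring.
Qed.

Lemma product_is_digit_system : is_digit_system M.
Proof.
have [deg1 lead1 const1 fin1 _] := dsN1.
have [deg2 lead2 const2 fin2 _] := dsN2.
(* Although [E] may have zero divisors, the product of the leading coefficients is nonzero, so
   degrees add. *)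
have nz12 := lreg_neq0 (lregM lead1 lead2).
split.
- rewrite size_proper_mul // -subn1 ltn_subRL; exact: ltnW (leq_add deg1 deg2).
- rewrite lead_coef_proper_mul //; exact: lregM.
- rewrite coef0M; exact: lregM.
- by rewrite coef0M; apply: finite_pquotM.
- exact: product_reps.
Qed.

(** The canonical projection; the chosen representative is immaterial because multiples of [P1 * P2]
    are multiples of [P1]. *)
Definition reduce1 (A : pquot (P1 * P2)) : pquot P1 := \pi_(pquot P1) (repr A).

Lemma reduce1_pi f : reduce1 (\pi_(pquot (P1 * P2)) f) = \pi_(pquot P1) f.
Proof.
have /pi_pquot_eqP[u fu] : \pi_(pquot (P1 * P2)) (repr (\pi_(pquot (P1 * P2)) f)) =
                            \pi_(pquot (P1 * P2)) f.
  by rewrite reprK.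
by apply/pi_pquot_eqP; exists (u * P2); rewrite fu mulrA mulrAC.
Qed.

(** Well defined on classes, since [P1] times a multiple of [P2] is a multiple of [P1 * P2]. *)
Definition mulP1 (B : pquot P2) : pquot (P1 * P2) := \pi_(pquot (P1 * P2)) (P1 * repr B).

Lemma mulP1_pi h : mulP1 (\pi_(pquot P2) h) = \pi_(pquot (P1 * P2)) (P1 * h).
Proof.
have /pi_pquot_eqP[u hu] : \pi_(pquot P2) (repr (\pi_(pquot P2) h)) = \pi_(pquot P2) h.
  by rewrite reprK.
by apply/pi_pquot_eqP; exists u; rewrite -mulrBr hu mulrCA.
Qed.

Lemma mulP10 : mulP1 0 = 0.
Proof. by rewrite -[0 in LHS](raddf0 \pi_(pquot P2)) mulP1_pi mulr0 raddf0. Qed.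

Lemma reduce1_shift : {morph reduce1 : A / T A >-> T1 A}.
Proof.
move=> A; have [_ [d N1d [e N2e <-]]] := digit_shiftP product_is_digit_system A.
rewrite -/T; elim/pquot_ind: (T A) => g.
rewrite -pi_pquotM -raddfD => ->; rewrite !reduce1_pi.
have -> : \pi_(pquot P1) (d%:P + e%:P * P1 + 'X * g) = embed P1 d + qX P1 * \pi_(pquot P1) g.
  rewrite -pi_pquotM -raddfD; apply/pi_pquot_eqP; exists e%:P.
  ring.
by rewrite /T1 digit_shift_eq //; exists d.
Qed.

Lemma mulP1_shift : N1 0 -> {morph mulP1 : B / T2 B >-> T B}.
Proof.
move=> N10 B; have [_ [e N2e <-]] := digit_shiftP dsN2 B.
rewrite -/T2; elim/pquot_ind: (T2 B) => k.
rewrite -pi_pquotM -raddfD => ->; rewrite !mulP1_pi.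
rewrite mulrDr mulrCA raddfD [X in _ + X]pi_pquotM /T digit_shift_eq //.
  exact: product_is_digit_system.
(* Here [0] in [N1] makes [e%:P * P1] itself a product digit. *)
by exists 0 => //; exists e; rewrite // add0r (mulrC e%:P).
Qed.

Lemma iter_shift_mulP1 : finite_expansion (embed P1 @` N1) ->
  forall A, exists n B, iter n T A = mulP1 B.
Proof.
move=> fin1 A; have [n] := fin1 (reduce1 A).
rewrite -/T1 -(iter_morph reduce1_shift) => An; exists n.
(* The kernel of [reduce1] consists of the multiples of [P1], which is the image of [mulP1]. *)
move: An; elim/pquot_ind: (iter n T A) => f.
rewrite reduce1_pi => /pi_pquot_eq0P[u ->].
by exists (\pi_(pquot P2) u); rewrite mulP1_pi (mulrC u).
Qed.

End Product.

Theorem theorem4p1 (E : comNzRingType) (P1 P2 : {poly E}) (N1 N2 : set E)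
    (dsN1 : is_digit_system (embed P1 @` N1))
    (dsN2 : is_digit_system (embed P2 @` N2)) :
  [/\ is_digit_system (product_digits P1 P2 N1 N2),
      N1 0 -> finite_expansion (embed P1 @` N1) ->
        finite_expansion (embed P2 @` N2) ->
        finite_expansion (product_digits P1 P2 N1 N2)
    & N1 0 -> finite_expansion (embed P1 @` N1) ->
        periodic_expansion (embed P2 @` N2) ->
        periodic_expansion (product_digits P1 P2 N1 N2)].
Proof.
split; first exact: product_is_digit_system.
- move=> N10 fin1 fin2 A.
  have [n [B AB]] := iter_shift_mulP1 dsN1 dsN2 fin1 A.
  have [m Bm] := fin2 B; exists (m + n)%N.
  rewrite iterD AB -(iter_morph (mulP1_shift dsN1 dsN2 N10)) Bm.
  exact: mulP10.
move=> N10 fin1 per2 A.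
have [n [B AB]] := iter_shift_mulP1 dsN1 dsN2 fin1 A.
(* The preperiod grows by the [n] shifts spent reaching a multiple of [P1]; the period [l] of [B] is
   kept. *)
have [m [l [l_gt0 Bper]]] := per2 B; exists (m + n)%N, l; split=> // i le_mn_i.
have le_ni : (n <= i)%N := leq_trans (leq_addl m n) le_mn_i.
rewrite -(subnK le_ni) addnAC !iterD -iterD AB.
rewrite -!(iter_morph (mulP1_shift dsN1 dsN2 N10)) Bper //.
by rewrite leq_subRL // addnC.
Qed.
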